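(* Let $K$ be a compact metric space and let $\mu \in M(K)$ with $\|\mu\| = 1$. Let $h = \frac{d\mu}{d|\mu|}$. Then there is a sequence $(x_n)_{n\ge1}$ in $K$ and a sequence of signs $(\varepsilon_n)_{n\ge1}$ in $\{\pm 1\}$ (where $\varepsilon_n = h(x_n)$) such that for every $\mu$-Riemann integrable function $f : K \to \mathbb{R}$ we have (a) $\lim_{N \to \infty} \frac{1}{N} \sum_{k=1}^N f(x_k) = \int_K f\, d|\mu|$; in particular $(x_n)$ is $|\mu|$-u.d.; (b) $\lim_{N \to \infty} \frac{1}{N} \sum_{k=1}^N \varepsilon_k f(x_k) = \int_K f\, d\mu$; (c) $\lim_{N \to \infty} \frac{1}{2N} \sum_{k=1}^N (1 + \varepsilon_k) f(x_k) = \int_K f\, d\mu^+$; and (d) $\lim_{N \to \infty} \frac{1}{2N} \sum_{k=1}^N (1 - \varepsilon_k) f(x_k) = \int_K f\, d\mu^-$.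
   Context: $M(K)$ is the space of finite regular signed (real) Borel measures on $K$ with norm $\|\mu\| = |\mu|(K)$, where $|\mu|$ is the total variation measure; $\mu^+ = \frac12(|\mu| + \mu)$ and $\mu^- = \frac12(|\mu| - \mu)$ are the positive and negative variations of $\mu$. The function $h = \frac{d\mu}{d|\mu|}$ is the Radon-Nikodym derivative of $\mu$ with respect to $|\mu|$, taken to be a Borel function $h : K \to \mathbb{R}$ with $|h(x)| = 1$ for all $x \in K$ and $d\mu = h\, d|\mu|$. A function $f: K \to \mathbb{R}$ is $\mu$-Riemann integrable if it is bounded and its set of discontinuity points has $|\mu|$-measure zero. A sequence $(x_n)$ in $K$ is $\nu$-u.d., for a probability measure $\nu$, if $\lim_{N\to\infty} \frac1N\sum_{k=1}^N f(x_k) = \int_K f\, d\nu$ for all continuous $f: K \to \mathbb{R}$. *)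

(* Defs.v *)
From HB Require Import structures.
From mathcomp Require Import all_boot all_order all_algebra.
From mathcomp Require Import all_classical all_reals all_analysis.

Set Implicit Arguments.
Unset Strict Implicit.
Unset Printing Implicit Defensive.

Import Order.TTheory GRing.Theory Num.Theory.
Import numFieldNormedType.Exports.

Local Open Scope classical_set_scope.
Local Open Scope ring_scope.

(* The library builds measurable types on pointed types only.  For a space
   carrying a charge of norm 1 this is no restriction: it is nonempty. *)
#[short(type="pmetricType")]
HB.structure Definition PointedMetric (R : numDomainType) :=
  {K of Pointed K & Metric R K}.

Notation borel K := (g_sigma_algebraType (@open K)).

Section variations.
Context d (T : measurableType d) (R : realType).
Variable mu : {charge set T -> \bar R}.

Lemma hahn_decomposition_exists :
  exists PN : set T * set T, hahn_decomposition mu PN.1 PN.2.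
Proof. by have [P [N PN]] := Hahn_decomposition mu; exists (P, N). Qed.

(* |mu|; on measurable sets it does not depend on the Hahn decomposition
   (see Hahn_decomposition_uniq). *)
Definition charge_tv : set T -> \bar R :=
  charge_variation (projT2 (cid hahn_decomposition_exists)).

HB.instance Definition _ := Measure.on charge_tv.
HB.instance Definition _ := Charge.on charge_tv.

(* Charges are unconstrained on nonmeasurable sets whereas measures are
   nonnegative everywhere, hence the default value 0 below. *)
Definition pos_variation (A : set T) : \bar R :=
  if A \in measurable then (2^-1%:E * (charge_tv A + mu A))%E else 0%E.

Definition neg_variation (A : set T) : \bar R :=
  if A \in measurable then (2^-1%:E * (charge_tv A - mu A))%E else 0%E.

Let hahn := projT2 (cid hahn_decomposition_exists).

Let tvB A : measurable A -> (0 <= charge_tv A - mu A)%E.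
Proof.
move=> mA; rewrite sube_ge0 ?fin_num_measure//.
exact: le_trans (lee_abs _) (abse_charge_variation hahn mA).
Qed.

Let tvD A : measurable A -> (0 <= charge_tv A + mu A)%E.
Proof.
move=> mA; rewrite -[mu A]oppeK sube_ge0 ?fin_numN ?fin_num_measure//.
apply: le_trans (abse_charge_variation hahn mA).
by rewrite -abseN lee_abs.
Qed.

Let pos_variationE :
  pos_variation = crestr0 (cscale 2^-1 (cadd charge_tv mu)) measurableT.
Proof. by apply/funext => A; rewrite /crestr0 /crestr setIT. Qed.

Let neg_variationE : neg_variation =
  crestr0 (cscale 2^-1 (cadd charge_tv (copp mu))) measurableT.
Proof. by apply/funext => A; rewrite /crestr0 /crestr setIT. Qed.

Let pos_variation0 : pos_variation set0 = 0%E.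
Proof. by rewrite pos_variationE charge0. Qed.

Let pos_variation_ge0 A : (0 <= pos_variation A)%E.
Proof.
rewrite /pos_variation; case: ifPn => // /set_mem mA.
by rewrite mule_ge0// ?lee_fin// tvD.
Qed.

Let pos_variation_sigma_additive : semi_sigma_additive pos_variation.
Proof. by rewrite pos_variationE; exact: charge_semi_sigma_additive. Qed.

HB.instance Definition _ := isMeasure.Build _ _ _ pos_variation
  pos_variation0 pos_variation_ge0 pos_variation_sigma_additive.

Let neg_variation0 : neg_variation set0 = 0%E.
Proof. by rewrite neg_variationE charge0. Qed.

Let neg_variation_ge0 A : (0 <= neg_variation A)%E.
Proof.
rewrite /neg_variation; case: ifPn => // /set_mem mA.
by rewrite mule_ge0// ?lee_fin// tvB.
Qed.

Let neg_variation_sigma_additive : semi_sigma_additive neg_variation.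
Proof. by rewrite neg_variationE; exact: charge_semi_sigma_additive. Qed.

HB.instance Definition _ := isMeasure.Build _ _ _ neg_variation
  neg_variation0 neg_variation_ge0 neg_variation_sigma_additive.

Definition charge_integral (f : T -> R) : R :=
  \int[pos_variation]_x f x - \int[neg_variation]_x f x.

(* Unlike 'd mu '/d |mu|, a real-valued version of absolute value 1 everywhere
   is required. *)
Definition sign_density (h : T -> R) : Prop :=
  [/\ measurable_fun [set: T] h, forall x, `|h x| = 1 &
      forall A, measurable A ->
        mu A = (\int[charge_tv]_(x in A) (h x)%:E)%E].

End variations.

Section borel_charges.
Context (R : realType) (K : pmetricType R).

Definition regular_charge (mu : {charge set (borel K) -> \bar R}) : Prop :=
  forall A : set (borel K), measurable A ->
    charge_tv mu A = ereal_sup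
      [set charge_tv mu C | C in [set C : set K | compact C /\ C `<=` A]]
    /\
    charge_tv mu A = ereal_inf
      [set charge_tv mu U | U in [set U : set K | open U /\ A `<=` U]].

(* Such an f need not be Borel.  The library's integral of a function g >= 0 is
   the supremum of the integrals of the Borel simple functions below g, also
   when g is not measurable.  Since f is bounded and continuous |mu|-a.e., its
   positive and negative parts are measurable for the completion of |mu|, so
   that this supremum is their integral for the completed measure. *)
Definition riemann_integrable (mu : {charge set (borel K) -> \bar R})
    (f : K -> R) : Prop :=
  bounded_fun f /\
  (charge_tv mu).-negligible [set x : K | ~ {for x, continuous f}].

(* Sequences are indexed from 1; their value at 0 is irrelevant. *)
Definition uniformly_distributed (nu : {measure set (borel K) -> \bar R})
    (x : nat -> K) : Prop :=
  nu [set: K] = 1%E /\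
  forall f : K -> R, continuous f ->
    N%:R^-1 * \sum_(1 <= k < N.+1) f (x k) @[N --> \oo] --> \int[nu]_y f y.

End borel_charges.

(* Main.v *)
Require Import Defs.
From HB Require Import structures.
From mathcomp Require Import all_boot all_order all_algebra.
From mathcomp Require Import all_classical all_reals all_analysis.
From mathcomp Require Import ring lra zify.

(** The sequence is built so that it visits countably many Borel pieces of K
with the right frequencies; Riemann integrable functions are then handled as in
the classical theory of the Riemann integral, by upper and lower step functions.

Let nu = |mu|.  For each m, compactness gives a finite Borel partition of K into
cells of diameter at most 1/(m+1) ([small_measurable_partition]).  Intersecting
the cells with {h = 1} and {h = -1} gives a countable family of pieces.

A sequence with frequency nu(F) in every member F of a countable family exists
by the strong law of large numbers, but it can also be chosen greedily
([exists_sequence_of_frequencies]).  Let D_j(n) be the sum of 1_{F_j} - nu(F_j)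
over the first n points, and consider the potential sum_j w_j D_j(n)^2 with
summable weights w_j.  Since 1_{F_j} - nu(F_j) has mean zero, some choice of the
next point makes the first-order term of the increment of the potential
nonpositive; the increment is then bounded, the potential grows at most linearly
in n, and D_j(n) = O(sqrt n).

For the integrals, mu+ and mu- are the restrictions of nu to {h = 1} and
{h = -1} ([pos_variation_sign_set], [neg_variation_sign_set]).  So the averages
over cells weighted by (1 + eps_k)/2, by (1 - eps_k)/2 and by 1 converge to mu+,
mu- and nu of the cell.  A bounded f lies between the step functions taking its
supremum and its infimum on every cell of level m, and the averages of these
step functions converge.  Where f is continuous their difference tends to 0 as m
grows, so by dominated convergence their integrals have a common limit when f is
continuous almost everywhere; both the averages and the integral of f are
squeezed ([weighted_average_cvg]).  This gives the limits for |mu|, mu+ and mu-;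
the limit of the signed averages is the difference of those for mu+ and mu-. *)

Set Implicit Arguments.
Unset Strict Implicit.
Unset Printing Implicit Defensive.
Import Order.TTheory GRing.Theory Num.Theory.
Import numFieldNormedType.Exports.
Local Open Scope classical_set_scope.
Local Open Scope ring_scope.

(** * Sequences with prescribed frequencies *)

Section indicator_combinations.
Context d (T : measurableType d) (R : realType).
Variables (nu : {finite_measure set T -> \bar R}) (n : nat).
Variables (a : 'I_n -> R) (F : 'I_n -> set T).
Hypothesis mF : forall i, measurable (F i).

Lemma integrable_sum_indic :
  nu.-integrable [set: T] (EFin \o (fun y => \sum_(i < n) a i * \1_(F i) y)).
Proof.
rewrite (_ : _ \o _ = fun y => (\sum_(i < n) (a i)%:E * (\1_(F i) y)%:E)%E).
  by apply: integrable_sum => // i _; apply: integrableZl => //;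
    exact: integrable_indic.
by apply/funext => y /=; rewrite -sumEFin.
Qed.

Lemma Rintegral_sum_indic :
  \int[nu]_y (\sum_(i < n) a i * \1_(F i) y) =
  \sum_(i < n) a i * fine (nu (F i)).
Proof.
have iF i : nu.-integrable [set: T] (fun y => (\1_(F i) y)%:E).
  exact: integrable_indic.
rewrite /Rintegral; under eq_integral do rewrite -sumEFin.
under eq_integral do under eq_bigr do rewrite EFinM.
rewrite integral_sum//; last by move=> i; exact: integrableZl.
rewrite (eq_bigr (fun i => (a i * fine (nu (F i)))%:E)) ?sumEFin// => i _.
by rewrite integralZl// integral_indic// setIT EFinM fineK// fin_num_measure.
Qed.

End indicator_combinations.

(** If g exceeded its mean everywhere, the positive function g - m would have
integral 0, hence vanish almost everywhere, on a space of mass 1. *)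
Lemma exists_le_mean d (T : measurableType d) (R : realType)
    (nu : {finite_measure set T -> \bar R}) (g : T -> R) :
  nu [set: T] = 1%E -> nu.-integrable [set: T] (EFin \o g) ->
  exists y, g y <= \int[nu]_y g y.
Proof.
move=> nu1 ig; apply: contrapT => /forallNP g_gt.
set m := \int[nu]_y g y.
have gm y : 0 < g y - m by rewrite subr_gt0 ltNge; apply/negP/g_gt.
have icst : nu.-integrable [set: T] (EFin \o cst m).
  exact: finite_measure_integrable_cst.
have igm := integrableB measurableT ig icst.
have /integrableP[mgm _] := igm.
have : (\int[nu]_y `|(g y)%:E - m%:E| = 0)%E.
  under eq_integral => y _ do rewrite -EFinB gee0_abs ?lee_fin ?ltW//.
  have -> : (\int[nu]_y (g y - m)%:E = \int[nu]_y (g y)%:E - \int[nu]_y m%:E)%E.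
    by rewrite -integralB.
  have -> : (\int[nu]_y m%:E = m%:E)%E.
    by rewrite (@integral_cst _ _ _ nu _ measurableT m%:E) -[RHS]mule1 -nu1.
  by rewrite -[X in (X - _)%E]fineK ?subee//; exact: integrable_fin_num.
move/(ae_eq_integral_abs nu measurableT mgm) => [A [mA A0 subA]].
have : nu [set: T] = 0%E.
  have -> : [set: T] = A; last by [].
  apply/seteqP; split => // y _; apply: subA => /= /(_ I) /eqP.
  by rewrite eqe; apply/negP; rewrite gt_eqF.
by rewrite nu1 => /eqP; rewrite onee_eq0.
Qed.

Lemma sum_inv_consecutive (R : realType) n :
  \sum_(j < n) ((j.+1 * j.+2)%:R : R)^-1 = 1 - n.+1%:R^-1.
Proof.
elim: n => [|n IH]; first by rewrite big_ord0 invr1 subrr.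
rewrite big_ord_recr /= IH natrM.
have -> : n.+2%:R = n.+1%:R + 1 :> R by rewrite natr1.
have : 0 < n.+1%:R :> R by rewrite ltr0n.
move: n.+1%:R => a a0; field; lra.
Qed.

Section balanced_sequence.
Context d (T : measurableType d) (R : realType).
Variables (nu : {finite_measure set T -> \bar R}) (F : nat -> set T).
Hypotheses (nu1 : nu [set: T] = 1%E) (mF : forall j, measurable (F j)).

Let p j : R := fine (nu (F j)).
(* These weights are summable, with sum at most 1, and satisfy
   w_n (n+1)^2 <= 1, so that taking a new set into account once n+1 points are
   chosen adds at most 1 to the potential. *)
Let w j : R := ((j.+1 * j.+2)%:R)^-1.

Let p01 j : 0 <= p j <= 1.
Proof.
rewrite fine_ge0 ?measure_ge0//= -lee_fin fineK ?fin_num_measure//.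
by rewrite -nu1 le_measure ?inE.
Qed.

Let w_ge0 j : 0 <= w j. Proof. by rewrite invr_ge0. Qed.

Let sqr_dev j y : (\1_(F j) y - p j) ^+ 2 <= 1.
Proof.
have /andP[p0 p1] := p01 j.
rewrite indicE; move: (p j) p0 p1 => q q0 q1; case: (_ \in _) => /=.
  by rewrite expr2; nra.
by rewrite sub0r sqrrN expr_le1.
Qed.

(** The linear combination of the centred indicators has mean zero, so it is
nonpositive somewhere.  For D the vector of current deviations it is half of the
first-order variation of the potential when the point y is added. *)
Lemma exists_opposing_point (D : nat -> R) n :
  exists y, \sum_(j < n) w j * D j * (\1_(F j) y - p j) <= 0.
Proof.
have mF' (j : 'I_n) : measurable (F j) by [].
have [y] := exists_le_mean nu1 (integrable_sum_indic nu (fun j => w j * D j) mF').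
rewrite Rintegral_sum_indic// => le_y.
exists y; under eq_bigr do rewrite mulrBr.
by rewrite sumrB subr_le0.
Qed.

Let next (D : nat -> R) n : T := projT1 (cid (exists_opposing_point D n)).

Let nextP (D : nat -> R) n : \sum_(j < n) w j * D j * (\1_(F j) (next D n) - p j) <= 0.
Proof. exact: projT2 (cid (exists_opposing_point D n)). Qed.

(** The state of the greedy construction: the deviations of the first n points
determine the point of index n, hence the next deviations. *)
Fixpoint deviation n : nat -> R :=
  if n is n'.+1 then
    fun j => deviation n' j + (\1_(F j) (next (deviation n') n') - p j)
  else fun=> 0.

Definition balanced n : T := next (deviation n) n.

Lemma deviationE n j :
  deviation n j = \sum_(k < n) (\1_(F j) (balanced k) - p j).
Proof.
by elim: n => [|n IH]; rewrite ?big_ord0// big_ord_recr /= IH.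
Qed.

Let deviation_le n j : `|deviation n j| <= n%:R.
Proof.
elim: n => [|n IH] /=; first by rewrite normr0.
rewrite -natr1 (le_trans (ler_normD _ _))// lerD//.
by rewrite -(@ler_sqr _ _ 1) ?nnegrE// real_normK ?num_real// expr1n.
Qed.

(** Going from n to n+1 points, the sets of index below n contribute a
nonpositive first-order term, by the choice of the point, and a second-order
term bounded by the sum of their weights; the set of index n contributes at most
1 because its deviation is at most n+1. *)
Lemma potential_le n : \sum_(j < n) w j * deviation n j ^+ 2 <= 2 * n%:R.
Proof.
elim: n => [|n IH]; first by rewrite big_ord0 mulr0.
rewrite big_ord_recr /=.
have last_le : w n * deviation n.+1 n ^+ 2 <= 1.
  rewrite mulrC ler_pdivrMr ?ltr0n// mul1r.
  have := deviation_le n.+1 n; rewrite -ler_sqr ?nnegrE// real_normK ?num_real//.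
  move/le_trans; apply; rewrite -natrX ler_nat; nia.
have step_le : \sum_(j < n) w j * deviation n.+1 j ^+ 2 <=
    \sum_(j < n) w j * deviation n j ^+ 2 + 1.
  apply: (@le_trans _ _ (\sum_(j < n) w j * deviation n j ^+ 2 +
     (\sum_(j < n) w j * deviation n j * (\1_(F j) (balanced n) - p j)) *+ 2 +
     \sum_(j < n) w j)).
    rewrite -sumrMnl -!big_split /= ler_sum// => j _.
    have := ler_wpM2l (w_ge0 j) (sqr_dev j (balanced n)).
    by rewrite -/(balanced n); nra.
  have := nextP (deviation n) n; rewrite -/(balanced n).
  have : \sum_(j < n) w j <= 1.
    by rewrite /w sum_inv_consecutive gerBl invr_ge0.
  by set u := \sum_(j < n) w j; rewrite mulr2n; lra.
rewrite -natr1; move: last_le step_le => /=; lra.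
Qed.

Lemma deviation_sqr_le n j : (j < n)%N ->
  deviation n j ^+ 2 <= 2 * (j.+1 * j.+2)%:R * n%:R.
Proof.
move=> jn; have := potential_le n; rewrite (bigD1 (Ordinal jn))//= => h.
have : w j * deviation n j ^+ 2 <= 2 * n%:R.
  apply: le_trans h; rewrite lerDl sumr_ge0// => i _.
  by rewrite mulr_ge0// sqr_ge0.
by rewrite mulrC ler_pdivrMr ?ltr0n// mulrAC.
Qed.

(** The deviation is O(sqrt n), so it is negligible after division by n. *)
Lemma balanced_frequency j :
  n%:R^-1 * \sum_(k < n) \1_(F j) (balanced k) @[n --> \oo] --> p j.
Proof.
apply/cvgrPdist_le => e e0.
near=> n.
have n0 : 0 < n%:R :> R by near: n; exact: nbhs_infty_gtr.
have -> : p j - n%:R^-1 * \sum_(k < n) \1_(F j) (balanced k) =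
    - (n%:R^-1 * deviation n j).
  rewrite deviationE sumrB sumr_const card_ord -[p j *+ n]mulr_natl.
  by field; rewrite gt_eqF.
rewrite normrN -ler_sqr ?nnegrE ?(ltW e0)// real_normK ?num_real//.
rewrite exprMn exprVn mulrC ler_pdivrMr ?exprn_gt0//.
have jn : (j < n)%N by near: n; exact: nbhs_infty_gt.
apply: (le_trans (deviation_sqr_le jn)).
rewrite [n%:R ^+ 2]expr2 mulrA ler_pM2r// -ler_pdivrMl ?exprn_gt0//.
by near: n; exact: nbhs_infty_ger.
Unshelve. all: by end_near. Qed.

End balanced_sequence.

(** A deterministic form of the strong law of large numbers: it needs no infinite
product of probability spaces, and the error is O(n^(-1/2)) for each set. *)
Lemma exists_sequence_of_frequencies d (T : measurableType d) (R : realType)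
    (nu : {finite_measure set T -> \bar R}) (I : countType) (F : I -> set T) :
  nu [set: T] = 1%E -> (forall i, measurable (F i)) ->
  exists x : nat -> T, forall i,
    n%:R^-1 * \sum_(k < n) \1_(F i) (x k) @[n --> \oo] --> fine (nu (F i)).
Proof.
move=> nu1 mF; pose G j := if unpickle j is Some i then F i else set0.
have mG j : measurable (G j) by rewrite /G; case: unpickle.
exists (balanced nu1 mG) => i.
by have := @balanced_frequency _ _ _ _ _ nu1 mG (pickle i); rewrite /G pickleK.
Qed.

(** * Finite partitions into small Borel cells *)

Lemma measurable_find d (T : measurableType d) (s : seq (set T)) i :
  (forall A, A \in s -> measurable A) ->
  measurable [set y | find (fun A => y \in A) s = i].
Proof.
elim: s i => [|A s IH] i ms /=.
  by case: i => [|i]; [rewrite (_ : mkset _ = setT)|rewrite (_ : mkset _ = set0)]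
    => //; apply/seteqP; split.
have mA : measurable A by apply: ms; rewrite mem_head.
have {}IH j := IH j (fun B sB => ms B (mem_behead (s := A :: s) sB)).
case: i => [|i].
  rewrite (_ : mkset _ = A)//; apply/seteqP; split => y /=.
    by case: ifPn => // /set_mem.
  by move=> Ay; rewrite mem_set.
rewrite (_ : mkset _ = ~` A `&` [set y | find (fun A => y \in A) s = i]).
  by apply: measurableI => //; exact: measurableC.
apply/seteqP; split => y /=.
  by case: ifPn => //; rewrite notin_setE => Ay [].
by move=> [Ay <-]; rewrite memNset.
Qed.

(** A finite cover by open sets inside balls of radius e/2 is made disjoint by
sending each point to the first member of the cover that contains it; the cells
are the fibres of this index map c. *)
Lemma small_measurable_partition (R : realType) (K : pmetricType R) (e : R) :
  compact [set: K] -> 0 < e ->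
  exists (c : K -> nat) (r : nat),
    [/\ forall y, (c y < r)%N,
        forall i, measurable (c @^-1` [set i] : set (borel K)) &
        forall y z, c y = c z -> ball y e z].
Proof.
rewrite compact_cover => cptK e0.
have [|p _|D _ cover_D] := cptK K setT (fun p => (ball p (e / 2))°).
- by move=> p _; exact: open_interior.
- by exists p => //; apply: nbhsx_ballx; rewrite divr_gt0.
pose s : seq (set K) := [seq (ball p (e / 2))° | p <- finmap.enum_fset D].
pose c y := find (fun A => y \in A) s.
have has_s y : has (fun A => y \in A) s.
  have [p /= Dp py] := cover_D y I.
  by apply/hasP; exists (ball p (e / 2))°; [exact: map_f|rewrite mem_set].
exists c, (size s); split.
- by move=> y; rewrite -has_find.
- move=> i; apply: (@measurable_find _ (borel K)) => A /mapP[p _ ->].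
  by apply: sub_sigma_algebra; exact: open_interior.
- move=> y z cyz.
  have /set_mem yc := nth_find set0 (has_s y).
  have /set_mem zc := nth_find set0 (has_s z).
  rewrite -/(c z) -cyz in zc; rewrite -/(c y) in yc.
  have : nth set0 s (c y) \in s by rewrite mem_nth// -has_find.
  case/mapP => p _ Ep; rewrite Ep in yc zc.
  rewrite (splitr e); apply: (@ball_triangle _ _ p).
    by apply: ball_sym; exact: interior_subset yc.
  exact: interior_subset zc.
Qed.

(** * Integrals of nonmeasurable functions *)

Section nonmeasurable_integrands.
Context d (T : measurableType d) (R : realType).
Variable nu : {measure set T -> \bar R}.

(** The integral of a nonnegative function is defined as a supremum over the
simple functions below it, which makes monotonicity immediate. *)
Lemma ge0_le_integral_nonmeasurable (f g : T -> \bar R) :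
  (forall y, 0 <= f y)%E -> (forall y, f y <= g y)%E ->
  (\int[nu]_y f y <= \int[nu]_y g y)%E.
Proof.
move=> f0 fg; have g0 y : (0 <= g y)%E by exact: le_trans (fg y).
rewrite !ge0_integralE//; apply: le_ereal_sup => _ [u /= uf <-].
exists u => //= y; rewrite patch_setT; apply: le_trans (fg y).
by have := uf y; rewrite patch_setT.
Qed.

Lemma le_integral_nonmeasurable (f g : T -> \bar R) :
  (forall y, f y <= g y)%E -> (\int[nu]_y f y <= \int[nu]_y g y)%E.
Proof.
move=> fg; rewrite integralE [leRHS]integralE leeB//.
  apply: ge0_le_integral_nonmeasurable => y //.
  by apply: (@funepos_le _ _ setT) => [z _|]; [exact: fg|rewrite inE].
apply: ge0_le_integral_nonmeasurable => y //.
by apply: (@funeneg_le _ _ setT) => [z _|]; [exact: fg|rewrite inE].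
Qed.

(** The real integral is 0 by convention when the extended one is infinite; the
integrable bounds rule this out. *)
Lemma Rintegral_between (l f u : T -> R) :
  nu.-integrable [set: T] (EFin \o l) -> nu.-integrable [set: T] (EFin \o u) ->
  (forall y, l y <= f y <= u y) ->
  \int[nu]_y l y <= \int[nu]_y f y <= \int[nu]_y u y.
Proof.
move=> il iu lfu.
have lf : (\int[nu]_y (l y)%:E <= \int[nu]_y (f y)%:E)%E.
  by apply: le_integral_nonmeasurable => y; case/andP: (lfu y).
have fu : (\int[nu]_y (f y)%:E <= \int[nu]_y (u y)%:E)%E.
  by apply: le_integral_nonmeasurable => y; case/andP: (lfu y).
have fl : (\int[nu]_y (l y)%:E)%E \is a fin_num by exact: integrable_fin_num.
have fin_u : (\int[nu]_y (u y)%:E)%E \is a fin_num by exact: integrable_fin_num.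
have ff : (\int[nu]_y (f y)%:E)%E \is a fin_num.
  rewrite fin_numE -ltNye -ltey; apply/andP; split.
    by apply: lt_le_trans lf; rewrite ltNye; move: fl; rewrite fin_numE => /andP[].
  by apply: le_lt_trans fu _; rewrite ltey; move: fin_u; rewrite fin_numE => /andP[].
by rewrite /Rintegral !fine_le.
Qed.

End nonmeasurable_integrands.

(** * Averages of almost everywhere continuous functions *)

Section step_functions.
Context d (T : measurableType d) (R : realType).
Variables (nu : {finite_measure set T -> \bar R}) (c : T -> nat) (r : nat).
Hypotheses (c_lt : forall y, (c y < r)%N)
  (mc : forall i, measurable (c @^-1` [set i])).

Lemma step_sum_indic (a : nat -> R) y :
  a (c y) = \sum_(i < r) a i * \1_(c @^-1` [set (i : nat)]) y.
Proof.
rewrite (bigD1 (Ordinal (c_lt y)))//= big1 => [|i].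
  by rewrite addr0 indicE mem_set ?mulr1.
move=> ic; rewrite indicE memNset ?mulr0//= => ci.
by move/eqP: ic; apply; exact: val_inj.
Qed.

Lemma integrable_step (a : nat -> R) :
  nu.-integrable [set: T] (EFin \o (a \o c)).
Proof.
rewrite (_ : a \o c = fun y => \sum_(i < r) a i * \1_(c @^-1` [set (i : nat)]) y).
  exact: integrable_sum_indic.
by apply/funext => y; exact: step_sum_indic.
Qed.

Lemma step_average_cvg (x : nat -> T) (v : nat -> R) (a : nat -> R) :
  (forall i, n%:R^-1 * \sum_(k < n) v k * \1_(c @^-1` [set i]) (x k)
     @[n --> \oo] --> fine (nu (c @^-1` [set i]))) ->
  n%:R^-1 * \sum_(k < n) v k * a (c (x k)) @[n --> \oo] --> \int[nu]_y a (c y).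
Proof.
move=> freq; under eq_Rintegral do rewrite step_sum_indic.
rewrite Rintegral_sum_indic//.
rewrite (_ : (fun n => _) = fun n => \sum_(i < r) a i * (n%:R^-1 *
    \sum_(k < n) v k * \1_(c @^-1` [set (i : nat)]) (x k))).
  by apply: cvg_big => [|i _]; [exact: add_continuous|exact: cvgMr].
apply/funext => n; under eq_bigr do rewrite step_sum_indic mulr_sumr.
rewrite exchange_big /= mulr_sumr; apply: eq_bigr => i _.
rewrite mulrCA; congr (_ * _); rewrite mulr_sumr; apply: eq_bigr => k _.
by rewrite mulrCA.
Qed.

End step_functions.

Section weighted_average.
Context (R : realType) (K : pmetricType R).
Variable nu : {finite_measure set (borel K) -> \bar R}.
Variables (c : nat -> K -> nat) (r : nat -> nat).
Hypotheses (c_lt : forall m y, (c m y < r m)%N)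
  (mc : forall m i, measurable (c m @^-1` [set i] : set (borel K)))
  (c_small : forall m y z, c m y = c m z -> ball y m.+1%:R^-1 z).
Variables (x : nat -> K) (v : nat -> R).
Hypothesis v_ge0 : forall k, 0 <= v k.
Hypothesis freq : forall m i,
  n%:R^-1 * \sum_(k < n) v k * \1_(c m @^-1` [set i]) (x k)
    @[n --> \oo] --> fine (nu (c m @^-1` [set i])).
Variables (f : K -> R) (M : R).
Hypotheses (fM : forall y, `|f y| <= M)
  (cf : nu.-negligible [set y | ~ {for y, continuous f}]).

Let upper m i := sup (f @` (c m @^-1` [set i])).
Let lower m i := inf (f @` (c m @^-1` [set i])).

Let f_upper m y : f y <= upper m (c m y).
Proof.
apply: ub_le_sup; last by exists y.
by exists M => _ [z _ <-]; rewrite (le_trans (ler_norm _)).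
Qed.

Let lower_f m y : lower m (c m y) <= f y.
Proof.
apply: ge_inf; last by exists y.
by exists (- M) => _ [z _ <-]; have := fM z; rewrite ler_norml => /andP[].
Qed.

Let upper_le m y b : (forall z, c m z = c m y -> f z <= b) -> upper m (c m y) <= b.
Proof.
move=> fb; apply: ge_sup; first by exists (f y), y.
by move=> _ [z /= cz <-]; exact: fb.
Qed.

Let lower_ge m y b : (forall z, c m z = c m y -> b <= f z) -> b <= lower m (c m y).
Proof.
move=> fb; apply: lb_le_inf; first by exists (f y), y.
by move=> _ [z /= cz <-]; exact: fb.
Qed.

Let osc m y := upper m (c m y) - lower m (c m y).

Let osc_ge0 m y : 0 <= osc m y.
Proof. by rewrite subr_ge0 (le_trans (lower_f m y)). Qed.

Lemma oscillation_cvg0 y : {for y, continuous f} -> osc m y @[m --> \oo] --> 0.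
Proof.
move=> /cvgrPdist_le cfy; apply/cvgrPdist_le => e e0.
have /cfy/nbhs_ballP[t /= t0 ft] : 0 < e / 2 by rewrite divr_gt0.
near=> m.
have fz z : c m z = c m y -> `|f y - f z| <= e / 2.
  move=> /esym/c_small yz; apply: ft; apply: le_ball yz.
  by near: m; apply: filterS (near_infty_natSinv_lt (PosNum t0)) => m /ltW.
rewrite sub0r normrN ger0_norm// /osc.
have : upper m (c m y) <= f y + e / 2.
  by apply: upper_le => z /fz; rewrite ler_norml => /andP[]; lra.
have : f y - e / 2 <= lower m (c m y).
  by apply: lower_ge => z /fz; rewrite ler_norml => /andP[]; lra.
lra.
Unshelve. all: by end_near. Qed.

Let integrable_upper m : nu.-integrable [set: borel K] (EFin \o (upper m \o c m)).
Proof. exact: integrable_step. Qed.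

Let integrable_lower m : nu.-integrable [set: borel K] (EFin \o (lower m \o c m)).
Proof. exact: integrable_step. Qed.

(** Dominated convergence: the oscillations are step functions, hence measurable
although f need not be, and they are bounded by 2M. *)
Lemma Rintegral_oscillation_cvg0 : \int[nu]_y osc m y @[m --> \oo] --> 0.
Proof.
have mosc m := measurable_int nu
  (integrableB measurableT (integrable_upper m) (integrable_lower m)).
have ae_osc : \forall y \ae nu, [set: borel K] y -> (osc m y)%:E @[m --> \oo] --> 0%E.
  case: cf => A [mA A0 subA]; exists A; split => // y /= Py; apply: subA => cy.
  by apply: Py => _; apply: cvg_EFin; [exact: nearW|exact: oscillation_cvg0].
have osc_le : \forall y \ae nu, forall m, [set: borel K] y ->
    (`|(osc m y)%:E| <= (cst (M + M) y)%:E)%E.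
  apply: aeW => y m _; rewrite gee0_abs ?lee_fin// lerD//.
    by apply: upper_le => z _; rewrite (le_trans (ler_norm _)).
  by rewrite lerNl; apply: lower_ge => z _; have := fM z; rewrite ler_norml => /andP[].
have i2M : nu.-integrable [set: borel K] (EFin \o cst (M + M)).
  exact: finite_measure_integrable_cst.
have [_ _] := @dominated_convergence _ (borel K) _ nu setT measurableT
  (fun m y => (osc m y)%:E) (cst 0%E) _ mosc (measurable_cst _)
  ae_osc i2M osc_le.
by rewrite integral0 => /fine_cvg.
Qed.

(** The weights being nonnegative, the weighted averages of f lie between those
of its lower and upper step functions, as does its integral. *)
Lemma weighted_average_cvg :
  n%:R^-1 * \sum_(k < n) v k * f (x k) @[n --> \oo] --> \int[nu]_y f y.
Proof.
apply/cvgrPdist_le => e e0.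
have e2 : 0 < e / 2 by rewrite divr_gt0.
have /cvgrPdist_le/(_ _ e2) [m _ /(_ m (leqnn m))] := Rintegral_oscillation_cvg0.
rewrite sub0r normrN /osc
  (RintegralB measurableT (integrable_upper m) (integrable_lower m)) => osc_le.
have between y : lower m (c m y) <= f y <= upper m (c m y).
  by rewrite lower_f f_upper.
have /andP[lf fu] := Rintegral_between (integrable_lower m) (integrable_upper m) between.
have /cvgrPdist_le/(_ _ e2) cvgl := 
  @step_average_cvg _ (borel K) R nu (c m) (r m) (c_lt m) (mc m) x v (lower m) (@freq m).
have /cvgrPdist_le/(_ _ e2) cvgu := 
  @step_average_cvg _ (borel K) R nu (c m) (r m) (c_lt m) (mc m) x v (upper m) (@freq m).
near=> n.
have : `|\int[nu]_y lower m (c m y) -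
    n%:R^-1 * \sum_(k < n) v k * lower m (c m (x k))| <= e / 2.
  by near: n.
have : `|\int[nu]_y upper m (c m y) -
    n%:R^-1 * \sum_(k < n) v k * upper m (c m (x k))| <= e / 2.
  by near: n.
have : n%:R^-1 * \sum_(k < n) v k * lower m (c m (x k)) <=
    n%:R^-1 * \sum_(k < n) v k * f (x k).
  by rewrite ler_wpM2l ?invr_ge0// ler_sum// => k _; rewrite ler_wpM2l.
have : n%:R^-1 * \sum_(k < n) v k * f (x k) <=
    n%:R^-1 * \sum_(k < n) v k * upper m (c m (x k)).
  by rewrite ler_wpM2l ?invr_ge0// ler_sum// => k _; rewrite ler_wpM2l.
move: osc_le lf fu; rewrite !ler_norml => /andP[? ?] ? ? ? ? /andP[? ?] /andP[? ?].
apply/andP; split; lra.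
Unshelve. all: by end_near. Qed.

End weighted_average.

(** * The variations of a charge and its sign density *)

Section variations_of_a_charge.
Context d (T : measurableType d) (R : realType).
Variables (mu : {charge set T -> \bar R}) (h : T -> R).

Let pos_fin : fin_num_fun (pos_variation mu).
Proof.
move=> A mA; rewrite /pos_variation mem_set//.
by rewrite fin_numM// fin_numD !fin_num_measure.
Qed.

Let neg_fin : fin_num_fun (neg_variation mu).
Proof.
move=> A mA; rewrite /neg_variation mem_set//.
by rewrite fin_numM// fin_numB !fin_num_measure.
Qed.

HB.instance Definition _ := Measure_isFinite.Build d T R (charge_tv mu)
  (fin_num_measure (charge_tv mu)).
HB.instance Definition _ := Measure_isFinite.Build d T R (pos_variation mu) pos_fin.
HB.instance Definition _ := Measure_isFinite.Build d T R (neg_variation mu) neg_fin.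

Hypothesis hE : sign_density mu h.

Lemma measurable_sign_set s : measurable [set y | h y = s].
Proof.
have [mh _ _] := hE.
by rewrite -[mkset _]setTI; exact: (mh measurableT [set s]).
Qed.

Lemma sign_cases y : h y = 1 \/ h y = -1.
Proof.
have [_ /(_ y)/eqP + _] := hE.
by rewrite eqr_norml => /andP[/orP[/eqP|/eqP] hy _]; [left|right].
Qed.

(** This turns the sign weights (1 + eps)/2 and (1 - eps)/2 into indicators, so
that the weighted frequency of a cell is the frequency of a piece. *)
Lemma indic_sign_set (b : bool) y :
  \1_[set z | h z = (-1) ^+ b] y = (1 + (-1) ^+ b * h y) / 2 :> R.
Proof.
rewrite indicE; case: b; rewrite ?expr0 ?expr1; have [hy|hy] := sign_cases y.
- by rewrite memNset/= hy; [lra|move=> ?; lra].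
- by rewrite mem_set//= hy; lra.
- by rewrite mem_set//= hy; lra.
- by rewrite memNset/= hy; [lra|move=> ?; lra].
Qed.

Lemma charge_on_sign_set s (A : set T) : measurable A -> A `<=` [set y | h y = s] ->
  mu A = (s%:E * charge_tv mu A)%E.
Proof.
move=> mA Ah; have [_ _ ->//] := hE.
rewrite -(@integral_cst _ _ _ (charge_tv mu) _ mA s%:E).
by apply: eq_integral => y /set_mem /Ah /= ->.
Qed.

Let measurable_signI s (A : set T) : measurable A ->
  measurable (A `&` [set y | h y = s]).
Proof. by move=> mA; apply: measurableI => //; exact: measurable_sign_set. Qed.

Let signIU (A : set T) :
  (A `&` [set y | h y = 1]) `|` (A `&` [set y | h y = -1]) = A.
Proof.
apply/seteqP; split => y; first by move=> [[]|[]].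
by move=> Ay; case: (sign_cases y) => hy; [left|right].
Qed.

Let signII (A : set T) :
  (A `&` [set y | h y = 1]) `&` (A `&` [set y | h y = -1]) = set0.
Proof. by apply/seteqP; split => // y [[_ /= ->] [_ /= ?]]; lra. Qed.

Let tv_split (A : set T) : measurable A ->
  charge_tv mu A = (charge_tv mu (A `&` [set y | (h y = 1)%R]) +
                    charge_tv mu (A `&` [set y | (h y = -1)%R]))%E.
Proof.
by move=> mA; rewrite -[in LHS](signIU A) measureU//; exact: measurable_signI.
Qed.

Let mu_split (A : set T) : measurable A ->
  mu A = (charge_tv mu (A `&` [set y | (h y = 1)%R]) -
          charge_tv mu (A `&` [set y | (h y = -1)%R]))%E.
Proof.
move=> mA; rewrite -[in LHS](signIU A) chargeU//; try exact: measurable_signI.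
rewrite (@charge_on_sign_set 1) ?mul1e; last first.
- by move=> y [].
- exact: measurable_signI.
rewrite (@charge_on_sign_set (-1)) ?EFinN ?mulN1e//; last exact: measurable_signI.
Qed.

Lemma charge_tv_sign_sets (A : set T) : measurable A ->
  fine (charge_tv mu A) = fine (charge_tv mu (A `&` [set y | h y = 1])) +
                          fine (charge_tv mu (A `&` [set y | h y = -1])).
Proof.
move=> mA; rewrite tv_split// fineD// fin_num_measure//;
  exact: measurable_signI.
Qed.

(** On {h = 1} the charge is |mu| and on {h = -1} it is -|mu|, so half of
|mu| + mu only retains the first part. *)
Lemma pos_variation_sign_set (A : set T) : measurable A ->
  pos_variation mu A = charge_tv mu (A `&` [set y | h y = 1]).
Proof.
move=> mA; rewrite /pos_variation mem_set// tv_split// mu_split//.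
rewrite -(fineK (fin_num_measure (charge_tv mu) _ (measurable_signI 1 mA))).
rewrite -(fineK (fin_num_measure (charge_tv mu) _ (measurable_signI (-1) mA))).
move: (fine _) (fine _) => a b; congr EFin; lra.
Qed.

Lemma neg_variation_sign_set (A : set T) : measurable A ->
  neg_variation mu A = charge_tv mu (A `&` [set y | h y = -1]).
Proof.
move=> mA; rewrite /neg_variation mem_set// tv_split// mu_split//.
rewrite -(fineK (fin_num_measure (charge_tv mu) _ (measurable_signI 1 mA))).
rewrite -(fineK (fin_num_measure (charge_tv mu) _ (measurable_signI (-1) mA))).
move: (fine _) (fine _) => a b; congr EFin; lra.
Qed.

Lemma pos_variation_negligible (A : set T) :
  (charge_tv mu).-negligible A -> (pos_variation mu).-negligible A.
Proof.
move=> [B [mB B0 AB]]; exists B; split => //; rewrite pos_variation_sign_set//.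
apply/eqP; rewrite eq_le measure_ge0 andbT -B0 le_measure// inE//.
exact: measurable_signI.
Qed.

Lemma neg_variation_negligible (A : set T) :
  (charge_tv mu).-negligible A -> (neg_variation mu).-negligible A.
Proof.
move=> [B [mB B0 AB]]; exists B; split => //; rewrite neg_variation_sign_set//.
apply/eqP; rewrite eq_le measure_ge0 andbT -B0 le_measure// inE//.
exact: measurable_signI.
Qed.

End variations_of_a_charge.

Lemma continuous_riemann_integrable (R : realType) (K : pmetricType R)
    (mu : {charge set (borel K) -> \bar R}) (f : K -> R) :
  compact [set: K] -> continuous f -> riemann_integrable mu f.
Proof.
move=> cptK cf; split.
  have : compact (f @` setT).
    by apply: continuous_compact => //; exact: continuous_subspaceT.
  move=> /compact_bounded [B [Br fB]]; exists B; split => // b Bb y _.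
  by apply: (fB b Bb); exists y.
rewrite (_ : mkset _ = set0); first exact: negligible_set0.
by apply/seteqP; split => // y /= /(_ (cf y)).
Qed.

(** * The signed equidistribution theorem *)

Theorem theorem6 (R : realType) (K : pmetricType R)
    (cptK : compact [set: K])
    (mu : {charge set (borel K) -> \bar R})
    (mu_regular : regular_charge mu)
    (mu_norm1 : charge_tv mu [set: K] = 1%E)
    (h : K -> R) (hE : sign_density mu h) :
  exists (x : nat -> K) (eps : nat -> R),
    [/\ forall n, (0 < n)%N -> eps n = 1 \/ eps n = -1,
        forall n, (0 < n)%N -> eps n = h (x n),
        forall f : K -> R, riemann_integrable mu f ->
          [/\ N%:R^-1 * \sum_(1 <= k < N.+1) f (x k)
                @[N --> \oo] --> \int[charge_tv mu]_y f y,
              N%:R^-1 * \sum_(1 <= k < N.+1) eps k * f (x k)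
                @[N --> \oo] --> charge_integral mu f,
              (2 * N%:R)^-1 * \sum_(1 <= k < N.+1) (1 + eps k) * f (x k)
                @[N --> \oo] --> \int[pos_variation mu]_y f y &
              (2 * N%:R)^-1 * \sum_(1 <= k < N.+1) (1 - eps k) * f (x k)
                @[N --> \oo] --> \int[neg_variation mu]_y f y] &
        uniformly_distributed (charge_tv mu) x].
Proof.
have /choice[c /choice[r cP]] m : exists (c : K -> nat), exists (r : nat),
    [/\ forall y, (c y < r)%N,
        forall i, measurable (c @^-1` [set i] : set (borel K)) &
        forall y z, c y = c z -> ball y (m.+1%:R^-1 : R) z].
  by apply: small_measurable_partition; rewrite ?invr_gt0.
have c_lt m y : (c m y < r m)%N by have [] := cP m.
have mc m i : measurable (c m @^-1` [set i] : set (borel K)) by have [] := cP m.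
have c_small m y z : c m y = c m z -> ball y (m.+1%:R^-1 : R) z.
  by have [_ _] := cP m; exact.
(* The sign is (-1)^b: b = false is {h = 1} and b = true is {h = -1}. *)
pose piece m i (b : bool) : set (borel K) :=
  c m @^-1` [set i] `&` [set y | h y = (-1) ^+ b].
have mpiece m i b : measurable (piece m i b).
  by apply: measurableI => //; exact: (measurable_sign_set hE).
have [x piece_freq] := @exists_sequence_of_frequencies _ (borel K) R (charge_tv mu)
  (nat * nat * bool)%type (fun mib => piece mib.1.1 mib.1.2 mib.2) mu_norm1
  (fun mib => mpiece mib.1.1 mib.1.2 mib.2).
pose v (b : bool) k : R := \1_[set y | h y = (-1) ^+ b] (x k).
have freq b m i : n%:R^-1 * \sum_(k < n) v b k * \1_(c m @^-1` [set i]) (x k)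
    @[n --> \oo] --> fine (charge_tv mu (piece m i b)).
  have /= := piece_freq (m, i, b); apply: cvg_trans; apply: near_eq_cvg.
  apply: nearW => n.
  by congr (_ * _); apply: eq_bigr => k _; rewrite /piece indicI mulrC.
(* The averages run over 1 <= k <= N, whereas x is indexed from 0. *)
exists (fun n => x n.-1), (fun n => h (x n.-1)).
have vE b k : v b k = (1 + (-1) ^+ b * h (x k)) / 2 by exact: (indic_sign_set hE).
have freq_tv m i : n%:R^-1 * \sum_(k < n) 1 * \1_(c m @^-1` [set i]) (x k)
    @[n --> \oo] --> fine (charge_tv mu (c m @^-1` [set i])).
  rewrite (charge_tv_sign_sets hE)//.
  apply: cvg_trans (cvgD (@freq false m i) (@freq true m i)).
  apply: near_eq_cvg; apply: nearW => n /=.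
  rewrite fctE -mulrDr -big_split /=; congr (_ * _); apply: eq_bigr => k _.
  by rewrite !vE expr0 expr1; lra.
have freq_pos m i : n%:R^-1 * \sum_(k < n) v false k * \1_(c m @^-1` [set i]) (x k)
    @[n --> \oo] --> fine (pos_variation mu (c m @^-1` [set i])).
  by rewrite (pos_variation_sign_set hE)//; exact: freq.
have freq_neg m i : n%:R^-1 * \sum_(k < n) v true k * \1_(c m @^-1` [set i]) (x k)
    @[n --> \oo] --> fine (neg_variation mu (c m @^-1` [set i])).
  by rewrite (neg_variation_sign_set hE)//; exact: freq.
have v_ge0 b k : 0 <= v b k by rewrite /v indicE.
have shift (g : K -> R) N : \sum_(1 <= k < N.+1) g (x k.-1) = \sum_(k < N) g (x k).
  by rewrite big_add1 big_mkord.
have averages f : riemann_integrable mu f ->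
    [/\ N%:R^-1 * \sum_(1 <= k < N.+1) f (x k.-1)
          @[N --> \oo] --> \int[charge_tv mu]_y f y,
        (2 * N%:R)^-1 * \sum_(1 <= k < N.+1) (1 + h (x k.-1)) * f (x k.-1)
          @[N --> \oo] --> \int[pos_variation mu]_y f y &
        (2 * N%:R)^-1 * \sum_(1 <= k < N.+1) (1 - h (x k.-1)) * f (x k.-1)
          @[N --> \oo] --> \int[neg_variation mu]_y f y].
  move=> [[B [_ fB]] cf].
  have fM y : `|f y| <= `|B| + 1.
    by apply: fB => //; rewrite (le_lt_trans (ler_norm _))// ltrDl.
  have average := weighted_average_cvg c_lt mc c_small.
  split.
  - have := average (charge_tv mu) x (fun=> 1) (fun=> ler01) freq_tv f _ fM cf.
    apply: cvg_trans; apply: near_eq_cvg; apply: nearW => N.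
    by rewrite shift; congr (_ * _); apply: eq_bigr => k _; rewrite mul1r.
  - have := average (pos_variation mu) x (v false) (v_ge0 false) freq_pos f _ fM
      (pos_variation_negligible hE cf).
    apply: cvg_trans; apply: near_eq_cvg; apply: nearW => N.
    rewrite (shift (fun y => (1 + h y) * f y)) invfM -mulrA mulrCA.
    congr (_ * _); rewrite mulr_sumr; apply: eq_bigr => k _.
    by rewrite vE ?expr0 ?expr1; lra.
  - have := average (neg_variation mu) x (v true) (v_ge0 true) freq_neg f _ fM
      (neg_variation_negligible hE cf).
    apply: cvg_trans; apply: near_eq_cvg; apply: nearW => N.
    rewrite (shift (fun y => (1 - h y) * f y)) invfM -mulrA mulrCA.
    congr (_ * _); rewrite mulr_sumr; apply: eq_bigr => k _.
    by rewrite vE ?expr0 ?expr1; lra.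
split.
- by move=> n _; exact: (sign_cases hE).
- by [].
- move=> f rf; have [a_cvg c_cvg d_cvg] := averages f rf; split => //.
  apply: cvg_trans (cvgB c_cvg d_cvg).
  apply: near_eq_cvg; apply: nearW => N /=.
  rewrite !fctE -mulrBr -sumrB invfM -mulrA mulrCA mulr_sumr.
  by congr (_ * _); apply: eq_bigr => k _; lra.
- split => // f cf.
  by have [] := averages f (continuous_riemann_integrable mu cptK cf).
Qed.
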